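(* Fix $r\in\mathbb{N}$ and let $\mathscr{C}$ be a class of graphs such that for each $q\le r$ the class $\delta_q(\mathscr{C})$ has finite semi-ladder index. Then for any positive distance formula $\phi(\bar x;\bar y)$ of radius at most $r$ and size $k$, the domination-type problem corresponding to $\phi$ can be solved on graphs $G\in\mathscr{C}$ in time $f(k)\cdot\|G\|$, for some function $f$.
   Context: $\delta_q(x,y)$ expresses $\mathrm{dist}(x,y)\le q$; $\delta_q(\mathscr{C})=\{\delta_q(G):G\in\mathscr{C}\}$, where $\delta_q(G)$ is the bipartite graph with both parts $V(G)$ and $a,b$ adjacent iff $\mathrm{dist}_G(a,b)\le q$. In a bipartite graph $(L,R,E)$, sequences $a_1,\dots,a_n\in L$, $b_1,\dots,b_n\in R$ form a semi-ladder of order $n$ if $(a_i,b_j)\in E$ for all $i>j$ and $(a_i,b_i)\notin E$ for all $i$; a class has finite semi-ladder index if the orders of semi-ladders in its members are bounded. A distance formula $\phi(\bar x;\bar y)$ (with free variables split into disjoint tuples $\bar x,\bar y$) is a boolean combination of atoms $\delta_q(x,y)$ with $x$ in $\bar x$ and $y$ in $\bar y$; it is positive if the combination is positive; its radius is the maximal $q$ in its atoms and its size is the number of atoms. The domination-type problem corresponding to $\phi$ is: given a graph $G$, decide whether $G$ satisfies $\exists_{\bar x}\forall_{\bar y}\,\phi(\bar x;\bar y)$. $\|G\|$ denotes the number of vertices plus edges of $G$. *)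

(* Defs.v *)
From HB Require Import structures.
From mathcomp Require Import all_boot.

Set Implicit Arguments.
Unset Strict Implicit.
Unset Printing Implicit Defensive.

Record sgraph := SGraph {
  vertex :> finType;
  adj : rel vertex;
  adj_sym : symmetric adj;
  adj_irr : irreflexive adj
}.

(* [||G||], vertices plus edges, an edge being an unordered pair. *)
Definition edges (G : sgraph) : {set {set G}} :=
  [set [set p.1; p.2] | p : G * G & adj p.1 p.2].

Definition gsize (G : sgraph) : nat := #|G| + #|edges G|.

(* [dist(x,y) <= q]: some path from [x] to [y] has at most [q] edges (in
   particular this fails for every [q] when [y] is not reachable from [x]).
   The list [p] omits the starting vertex, so its size is the length. *)
Definition dist_le (G : sgraph) (q : nat) (x y : G) : bool :=
  [exists p : {bseq q of G}, path (@adj G) x p && (last x p == y)].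

Record bigraph := BiGraph {
  lpart : finType;
  rpart : finType;
  bedge : lpart -> rpart -> bool
}.

Definition semiladder (B : bigraph) (n : nat)
    (a : 'I_n -> lpart B) (b : 'I_n -> rpart B) : Prop :=
  (forall i j : 'I_n, j < i -> bedge (a i) (b j)) /\
  (forall i : 'I_n, ~~ bedge (a i) (b i)).

Definition finite_semiladder_index (D : bigraph -> Prop) : Prop :=
  exists N : nat, forall B : bigraph, D B ->
    forall (n : nat) (a : 'I_n -> lpart B) (b : 'I_n -> rpart B),
      semiladder a b -> n <= N.

Definition delta (q : nat) (G : sgraph) : bigraph := BiGraph (@dist_le G q).

Definition delta_class (q : nat) (C : sgraph -> Prop) : bigraph -> Prop :=
  fun B => exists2 G : sgraph, C G & B = delta q G.

(* Distance formulas whose free variables are split into a tuple of [s]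
   variables [x_i] and a tuple of [t] variables [y_j]; a tuple may contain
   variables that occur in no atom. *)
Inductive dformula (s t : nat) : Type :=
  | DAtom (q : nat) (i : 'I_s) (j : 'I_t)
  | DTrue
  | DFalse
  | DNot (phi : dformula s t)
  | DAnd (phi psi : dformula s t)
  | DOr (phi psi : dformula s t).

Arguments DTrue {s t}.
Arguments DFalse {s t}.

Fixpoint sat (G : sgraph) (s t : nat) (phi : dformula s t)
    (a : s.-tuple G) (b : t.-tuple G) : bool :=
  match phi with
  | DAtom q i j => dist_le q (tnth a i) (tnth b j)
  | DTrue => true
  | DFalse => false
  | DNot phi => ~~ sat phi a b
  | DAnd phi psi => sat phi a b && sat psi a b
  | DOr phi psi => sat phi a b || sat psi a b
  end.

Fixpoint positive (s t : nat) (phi : dformula s t) : bool :=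
  match phi with
  | DAtom _ _ _ | DTrue | DFalse => true
  | DNot _ => false
  | DAnd phi psi | DOr phi psi => positive phi && positive psi
  end.

Fixpoint radius (s t : nat) (phi : dformula s t) : nat :=
  match phi with
  | DAtom q _ _ => q
  | DTrue | DFalse => 0
  | DNot phi => radius phi
  | DAnd phi psi | DOr phi psi => maxn (radius phi) (radius psi)
  end.

Fixpoint fsize (s t : nat) (phi : dformula s t) : nat :=
  match phi with
  | DAtom _ _ _ => 1
  | DTrue | DFalse => 0
  | DNot phi => fsize phi
  | DAnd phi psi | DOr phi psi => fsize phi + fsize psi
  end.

Definition domination_problem (s t : nat) (phi : dformula s t)
    (G : sgraph) : Prop :=
  exists a : s.-tuple G, forall b : t.-tuple G, sat phi a b.

(* The machine model is a random-access machine with uniform cost: registers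
   and arrays hold natural numbers, and every elementary instruction and every
   test takes one step.  Since the only arithmetic is successor and
   predecessor, the largest number in memory grows by at most one per step
   beyond the input and the constants of the program, hence numbers have
   logarithmic length in any polynomial-time computation and unit cost is not
   an artefact of large words.  A program mentions finitely many arrays, which
   can be interleaved in a single memory; control flow is structured. *)
Record state := State {
  reg : nat -> nat;
  arr : nat -> nat -> nat
}.

Definition upd (T : Type) (g : nat -> T) (i : nat) (v : T) : nat -> T :=
  fun j => if j == i then v else g j.

Definition set_reg (m : state) (x v : nat) : state :=
  State (upd (reg m) x v) (arr m).

Definition set_arr (m : state) (A i v : nat) : state :=
  State (reg m) (upd (arr m) A (upd (arr m A) i v)).

(* Arguments named [x], [y] are register numbers, [A] is an array number;
   [IConst] takes a literal. *)
Inductive instr : Type :=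
  | IConst (x c : nat)
  | IMove (x y : nat)
  | ISucc (x y : nat)
  | IPred (x y : nat)
  | ILoad (x A y : nat)
  | IStore (A x y : nat).

Definition step (c : instr) (m : state) : state :=
  match c with
  | IConst x c => set_reg m x c
  | IMove x y => set_reg m x (reg m y)
  | ISucc x y => set_reg m x (reg m y).+1
  | IPred x y => set_reg m x (reg m y).-1
  | ILoad x A y => set_reg m x (arr m A (reg m y))
  | IStore A x y => set_arr m A (reg m x) (reg m y)
  end.

Inductive test : Type :=
  | TEq (x y : nat)
  | TLt (x y : nat).

Definition holds (b : test) (m : state) : bool :=
  match b with
  | TEq x y => reg m x == reg m y
  | TLt x y => reg m x < reg m y
  end.

Inductive prog : Type :=
  | Instr (c : instr)
  | Seq (p1 p2 : prog)
  | If (b : test) (p1 p2 : prog)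
  | While (b : test) (p : prog).

(* [exec p m m' t]: started in [m], the program [p] halts in [m'] after
   exactly [t] steps. *)
Inductive exec : prog -> state -> state -> nat -> Prop :=
  | ExecInstr c m : exec (Instr c) m (step c m) 1
  | ExecSeq p1 p2 m1 m2 m3 t1 t2 :
      exec p1 m1 m2 t1 -> exec p2 m2 m3 t2 ->
      exec (Seq p1 p2) m1 m3 (t1 + t2)
  | ExecIfTrue b p1 p2 m m' t :
      holds b m -> exec p1 m m' t -> exec (If b p1 p2) m m' t.+1
  | ExecIfFalse b p1 p2 m m' t :
      ~~ holds b m -> exec p2 m m' t -> exec (If b p1 p2) m m' t.+1
  | ExecWhileFalse b p m :
      ~~ holds b m -> exec (While b p) m m 1
  | ExecWhileTrue b p m1 m2 m3 t1 t2 :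
      holds b m1 -> exec p m1 m2 t1 -> exec (While b p) m2 m3 t2 ->
      exec (While b p) m1 m3 (t1 + t2).+1.

(* Adjacency lists: [vs] numbers the vertices (a vertex is named by its index
   in [vs]) and [nb v] lists the neighbours of [v].  Both orders are
   arbitrary. *)
Definition adjacency_lists (G : sgraph) (vs : seq G) (nb : G -> seq G) : Prop :=
  [/\ uniq vs, (forall v : G, v \in vs),
      (forall v : G, uniq (nb v)) & (forall u v : G, (v \in nb u) = adj u v)].

(* Register 0 holds the number of vertices.  Array 1 is the concatenation of
   the adjacency lists; the list of vertex [i] occupies the positions from
   [A0[i]] (included) to [A0[i+1]] (excluded).  Everything else is 0. *)
Definition input (G : sgraph) (vs : seq G) (nb : G -> seq G) : state :=
  let offsets :=
    [seq sumn (take i [seq size (nb v) | v <- vs]) | i <- iota 0 (size vs).+1] in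
  let lists := flatten [seq [seq index u vs | u <- nb v] | v <- vs] in
  State (fun x => if x == 0 then size vs else 0)
        (fun A i => if A == 0 then nth 0 offsets i
                    else if A == 1 then nth 0 lists i else 0).

(* [p] decides [Q] on the graphs of the class [C], within [T G] steps on every
   input representing [G]; the answer is yes iff register 0 is nonzero on
   halting.  Nothing is required on graphs outside [C]. *)
Definition decides_in_time (p : prog) (C : sgraph -> Prop)
    (Q : sgraph -> Prop) (T : sgraph -> nat) : Prop :=
  forall G : sgraph, C G ->
  forall (vs : seq G) (nb : G -> seq G), adjacency_lists vs nb ->
  exists (m : state) (t : nat),
    [/\ exec p (input vs nb) m t, t <= T G & (reg m 0 != 0) <-> Q G].

(* Main.v *)
Require Import Defs.
From mathcomp Require Import all_boot.
From mathcomp Require Import zify.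

(* Call [a] a solution if it dominates every [b].  Maintain counterexamples
   [b_0, ..., b_(j-1)]; look for an [a] that dominates all of them (if there is
   none, the answer is no), then for a [b_j] that this [a] does not dominate (if
   there is none, the answer is yes).  The pairs [(a_i, b_i)] met on the way form
   a semi-ladder for [phi], and by Ramsey's theorem a long one would contain a
   semi-ladder of order above the bound for the ball relation of a single atom.
   Hence the number of iterations is bounded in terms of the number of atoms, and
   the iteration is unrolled in the program.  Each search runs, for every choice
   of a clause of the normal form of [phi], one scan of the vertices per
   variable, testing membership in the balls around the vertices chosen before.
   A ball of radius [q] takes [q] rounds over all the adjacency lists. *)

Set Implicit Arguments.
Unset Strict Implicit.
Unset Printing Implicit Defensive.

(** * Ramsey's theorem for pairs *)

(** [m] stands for the sum of the sizes wanted in the [k] colours. The base value is 2 because two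
    elements form a pair and so provide a colour to return. *)
Fixpoint ramsey_bound (k m : nat) : nat :=
  if m is m'.+1 then (k * ramsey_bound k m').+1 else 2.

Lemma has_large_filter (T : eqType) (K : finType) (p : K -> pred T) (b : nat)
    (s : seq T) :
    all (fun x => [exists c, p c x]) s -> 0 < size s -> #|K| * b <= size s ->
  exists c, b <= size (filter (p c) s).
Proof.
move=> sp s_gt0 bs.
case: (boolP [exists c, b <= size (filter (p c) s)]) => [/existsP//|/existsPn small].
have le_s : size s <= \sum_c size (filter (p c) s).
  elim: s sp {s_gt0 bs small} => [|x s IH] //= /andP[/existsP[c cx] /IH].
  rewrite (bigD1 c) //= [in X in _ -> X](bigD1 c) //= cx /= => IHs.
  apply: leq_ltn_trans IHs _; rewrite addSn ltnS leq_add2l.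
  by apply: leq_sum => d _; case: ifP => //= _; apply: leqW.
have [c _] : exists c : K, True.
  by case: s sp s_gt0 {bs small le_s} => //= x s /andP[/existsP[c _] _] _; exists c.
have : \sum_c size (filter (p c) s) <= \sum_(c : K) b.-1.
  by apply: leq_sum => d _; move: (small d); lia.
rewrite sum_nat_const.
have : 0 < #|K| by apply/card_gt0P; exists c.
case: b bs small => [|b] bs small; first by case/negP: (small c).
move=> K_gt0 le_sum; have := leq_trans bs (leq_trans le_s le_sum).
by rewrite leq_pmul2l // ltnn.
Qed.

(** Induction on the sum of the wanted sizes [h]. By pigeonhole many later elements share a colour
    [c] with the first one; among them [h c] is lowered by one, and the first element is put back if
    the list found has colour [c]. *)
Lemma ramsey_off_diagonal (T : eqType) (K : finType) (P : K -> rel T)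
    (h : K -> nat) (s : seq T) :
    pairwise (fun x y => [exists c, P c x y]) s ->
    ramsey_bound #|K| (\sum_c h c) <= size s ->
  exists c s', [/\ subseq s' s, size s' = h c & pairwise (P c) s'].
Proof.
have trivial c : h c = 0 ->
    exists c s', [/\ subseq s' s, size s' = h c & pairwise (P c) s'].
  by move=> hc; exists c, [::]; rewrite sub0seq hc.
move Em: (\sum_c h c) => m.
elim: m h s Em trivial => [|m IH] h s Em trivial.
  case: s trivial => [|x [|y s]] //= trivial /andP[/andP[/existsP[c _] _] _] _.
  by apply: (trivial c); apply/eqP; rewrite -leqn0 -Em (bigD1 c) //= leq_addr.
have [c0 _ _] : exists2 c : K, true & 0 < h c.
  apply/exists_inP; apply: contraT => /exists_inPn h0.
  by move: Em; rewrite big1 // => c _; apply/eqP; move: (h0 c isT); rewrite lt0n negbK.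
case: s trivial => [//|x s] trivial /= /andP[xs ss]; rewrite ltnS => big_s.
have s_gt0 : 0 < size s.
  apply: leq_trans big_s; rewrite muln_gt0; apply/andP; split.
    by apply/card_gt0P; exists c0.
  by case: (m).
have [c big_c] := has_large_filter xs s_gt0 big_s.
have [hc|hc] := posnP (h c); first exact: trivial hc.
pose h' d := if d == c then (h c).-1 else h d.
have Em' : \sum_d h' d = m.
  have Eh : \sum_(d | d != c) h' d = \sum_(d | d != c) h d.
    by apply: eq_bigr => d dc; rewrite /h' (negPf dc).
  by move: Em; rewrite !(bigD1 c (P := predT)) //= Eh /h' eqxx; lia.
set s1 := filter _ s in big_c.
have sub1 : subseq s1 s by apply: filter_subseq.
have triv' d : h' d = 0 ->
    exists c s', [/\ subseq s' s1, size s' = h' c & pairwise (P c) s'].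
  by move=> hd; exists d, [::]; rewrite sub0seq hd.
have [d [s' [sub' sz' pw']]] := IH h' s1 Em' triv' (subseq_pairwise sub1 ss) big_c.
move: sz'; rewrite /h'; case: eqP => [Edc sz'|_ sz'].
  exists c, (x :: s'); split; first by rewrite /= eqxx (subseq_trans sub').
    by rewrite /= sz' prednK.
  rewrite pairwise_cons -{2}Edc pw' andbT.
  by apply/allP => y /(mem_subseq sub'); rewrite mem_filter => /andP[].
exists d, s'; split => //.
by apply: subseq_trans (subseq_cons _ _); apply: subseq_trans sub' sub1.
Qed.

(** * Distance formulas and their ladders *)

Section Formulas.
Variables s t : nat.
Implicit Types (phi : dformula s t) (pol : bool).

Definition atom : Type := (nat * ('I_s * 'I_t))%type.

Fixpoint atoms phi : seq atom :=
  match phi with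
  | DAtom q i j => [:: (q, (i, j))]
  | DTrue | DFalse => [::]
  | DNot phi => atoms phi
  | DAnd phi psi | DOr phi psi => atoms phi ++ atoms psi
  end.

Fixpoint evalf phi (v : atom -> bool) : bool :=
  match phi with
  | DAtom q i j => v (q, (i, j))
  | DTrue => true
  | DFalse => false
  | DNot phi => ~~ evalf phi v
  | DAnd phi psi => evalf phi v && evalf psi v
  | DOr phi psi => evalf phi v || evalf psi v
  end.

Definition atom_sat (G : sgraph) (a : s.-tuple G) (b : t.-tuple G) (x : atom) :=
  dist_le x.1 (tnth a x.2.1) (tnth b x.2.2).

Lemma sat_evalf (G : sgraph) phi (a : s.-tuple G) (b : t.-tuple G) :
  sat phi a b = evalf phi (atom_sat a b).
Proof. by elim: phi => //= [phi ->|phi -> psi ->|phi -> psi ->]. Qed.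

Lemma size_atoms phi : size (atoms phi) = fsize phi.
Proof. by elim: phi => //= phi IHphi psi IHpsi; rewrite size_cat IHphi IHpsi. Qed.

Lemma atoms_radius phi x : x \in atoms phi -> x.1 <= radius phi.
Proof.
elim: phi => //= [q i j|phi IHphi psi IHpsi|phi IHphi psi IHpsi].
- by rewrite inE => /eqP->.
- by rewrite mem_cat leq_max => /orP[/IHphi->|/IHpsi->]; rewrite ?orbT.
- by rewrite mem_cat leq_max => /orP[/IHphi->|/IHpsi->]; rewrite ?orbT.
Qed.

Lemma evalf_mono phi (v w : atom -> bool) :
    positive phi -> (forall x, x \in atoms phi -> v x -> w x) ->
  evalf phi v -> evalf phi w.
Proof.
elim: phi => //= [q i j|phi IHphi psi IHpsi|phi IHphi psi IHpsi].
- by move=> _ vw; apply: vw; rewrite mem_head.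
- move=> /andP[p1 p2] vw /andP[v1 v2]; apply/andP; split.
    by apply: IHphi v1 => // x x_phi; apply: vw; rewrite mem_cat x_phi.
  by apply: IHpsi v2 => // x x_psi; apply: vw; rewrite mem_cat x_psi orbT.
- move=> /andP[p1 p2] vw /orP[v1|v2]; apply/orP; [left|right].
    by apply: IHphi v1 => // x x_phi; apply: vw; rewrite mem_cat x_phi.
  by apply: IHpsi v2 => // x x_psi; apply: vw; rewrite mem_cat x_psi orbT.
Qed.

(** The atom found here becomes the colour of a pair in the Ramsey argument. *)
Lemma evalf_mono_neg phi (v w : atom -> bool) :
    positive phi -> evalf phi v -> ~~ evalf phi w ->
  exists2 x, x \in atoms phi & v x && ~~ w x.
Proof.
move=> pos hv hw; apply/hasP; apply: contraR hw => /hasPn vw.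
apply: evalf_mono hv => // x /vw; rewrite negb_and negbK => /orP[/negPf->|] //.
Qed.

Definition submasks phi : seq (seq atom) :=
  [seq mask (val m) (atoms phi) | m <- enum {: (size (atoms phi)).-tuple bool}].

(* Making the atoms of a clause equal to [pol] forces the value [pol] of the
   formula: for [true] this is a disjunctive normal form of [phi], and for
   [false] one of its negation. *)
Definition clauses phi pol : seq (seq atom) :=
  [seq S <- submasks phi | evalf phi (fun x => (x \in S) == pol) == pol].

Lemma size_clauses phi pol : size (clauses phi pol) <= 2 ^ fsize phi.
Proof.
apply: leq_trans (size_subseq (filter_subseq _ _)) _.
by rewrite size_map -cardE card_tuple card_bool size_atoms.
Qed.

Lemma clauses_atoms phi pol S :
  S \in clauses phi pol -> {subset S <= atoms phi} /\ size S <= fsize phi.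
Proof.
rewrite mem_filter => /andP[_ /mapP[m _ ->]].
split=> [x|]; first exact: mem_mask.
by rewrite -size_atoms; apply/size_subseq/mask_subseq.
Qed.

(** One way, take all atoms of value [pol]. The other way, start from the valuation that is [pol]
    exactly on the clause: moving further atoms to [pol] cannot spoil the value [pol] of a positive
    formula. *)
Lemma clausesP phi pol (v : atom -> bool) : positive phi ->
  reflect (exists2 S, S \in clauses phi pol & all (fun x => v x == pol) S)
          (evalf phi v == pol).
Proof.
move=> pos; apply: (iffP idP) => [/eqP vpol|[S]].
  exists [seq x <- atoms phi | v x == pol]; last exact: filter_all.
  rewrite mem_filter; apply/andP; split; last first.
    apply/mapP; exists (map_tuple (fun x => v x == pol) (in_tuple (atoms phi))).
      by rewrite mem_enum.
    by rewrite filter_mask.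
  case: pol vpol => [hv|/negbT hv]; [rewrite eqb_id|rewrite eqbF_neg].
    by apply: evalf_mono hv => // x xphi vx; rewrite mem_filter vx xphi.
  apply: contra hv; apply: evalf_mono => // x xphi.
  by rewrite mem_filter xphi andbT; case: (v x).
rewrite mem_filter => /andP[hS _] /allP vS.
case: pol hS vS => hS vS; [rewrite eqb_id|rewrite eqbF_neg].
  rewrite eqb_id in hS; apply: evalf_mono hS => // x _ /eqP /vS /eqP //.
rewrite eqbF_neg in hS; apply: contra hS; apply: evalf_mono => // x _ vx.
by rewrite eqbF_neg; apply/negP => /vS; rewrite vx.
Qed.

Definition ladder (G : sgraph) phi (L : seq (s.-tuple G * t.-tuple G)) : Prop :=
  all (fun p => ~~ sat phi p.1 p.2) L /\
  pairwise (fun p p' => sat phi p'.1 p.2) L.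

(** For [p] before [p'], at the [y] of [p] the formula holds with the [x] of [p'] and fails with
    that of [p]; an atom witnessing this colours the pair. One colour on [M.+2] entries gives a
    semi-ladder for a single ball relation. *)
Lemma size_ladder (G : sgraph) phi (L : seq (s.-tuple G * t.-tuple G)) (M : nat) :
    positive phi ->
    (forall q, q <= radius phi -> forall n a b,
       @semiladder (delta q G) n a b -> n <= M) ->
    ladder phi L ->
  size L < ramsey_bound (fsize phi) (fsize phi * M.+2).
Proof.
move=> pos bounded [/allP Ldiag Lpair]; rewrite ltnNge; apply/negP => big_L.
pose P (c : 'I_(size (atoms phi))) (p p' : s.-tuple G * t.-tuple G) :=
  atom_sat p'.1 p.2 (tnth (in_tuple (atoms phi)) c) &&
  ~~ atom_sat p.1 p.2 (tnth (in_tuple (atoms phi)) c).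
have Lcol : pairwise (fun p p' => [exists c, P c p p']) L.
  apply: (@sub_in_pairwise _ (mem L) _ _ _ _ (allss L) Lpair) => p p' pL _.
  rewrite sat_evalf => hv; have := Ldiag p pL; rewrite sat_evalf => hw.
  have [x xphi vw] := evalf_mono_neg pos hv hw.
  have [c xc] := seq_tnthP xphi.
  by apply/existsP; exists c; rewrite /P -xc.
have [|c [L' [subL' szL' pwL']]] :=
    @ramsey_off_diagonal _ _ P (fun=> M.+2) L Lcol.
  by rewrite sum_nat_const card_ord size_atoms.
case: L' subL' szL' pwL' => [//|p0 L'] subL' [szL'] pwL'.
pose x := tnth (in_tuple (atoms phi)) c.
have xr : x.1 <= radius phi by apply/atoms_radius/mem_tnth.
pose pt (i : 'I_M.+1) := nth p0 (p0 :: L') i.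
have := bounded _ xr M.+1 (fun i => tnth (pt i).1 x.2.1) (fun i => tnth (pt i).2 x.2.2).
suff H : @semiladder (delta x.1 G) M.+1 (fun i => tnth (pt i).1 x.2.1)
           (fun i => tnth (pt i).2 x.2.2).
  by move/(_ H); rewrite ltnn.
have Pij (i j : nat) : i < j -> j < M.+2 -> P c (nth p0 (p0 :: L') i) (nth p0 (p0 :: L') j).
  move=> ij jM; apply: (pairwiseP p0 pwL') => //; rewrite inE /= szL' //.
  exact: ltn_trans jM.
split=> [i j ji|i].
  by have /andP[] := Pij j i ji (ltnW (ltn_ord i)).
(* Failure at [i] is read off the colour of [i] and [i.+1], so the last of the [M.+2] entries is
   spent and the order is [M.+1]. *)
by have /andP[] := Pij i i.+1 (ltnSn i) (ltn_ord i).
Qed.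

End Formulas.

(** * Distances and sizes of graphs *)

Section Distance.
Variable G : sgraph.
Implicit Types (x y z : G) (q : nat).

Lemma dist_leP q x y :
  reflect (exists p, [/\ size p <= q, path (@adj G) x p & last x p = y])
          (dist_le q x y).
Proof.
apply: (iffP existsP) => [[p /andP[xp /eqP py]]|[p [pq xp py]]].
  by exists p; split=> //; apply: size_bseq.
by exists (Bseq pq); rewrite /= xp py eqxx.
Qed.

Lemma dist_le0 x y : dist_le 0 x y = (x == y).
Proof.
apply/dist_leP/eqP => [[[|z p] [] //]|->].
by exists [::].
Qed.

(** Cut the path before its last edge. This is the recursion that [round] carries out for all
    vertices at once. *)
Lemma dist_leS q x y :
  dist_le q.+1 x y = dist_le q x y || [exists z, adj y z && dist_le q x z].
Proof.
apply/dist_leP/orP => [[p [pq xp py]]|[/dist_leP[p [pq xp py]]|]].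
- case/lastP: p pq xp py => [|p z] pq xp py.
    by left; apply/dist_leP; exists [::].
  rewrite size_rcons ltnS in pq; rewrite last_rcons in py; subst z.
  rewrite rcons_path in xp; case/andP: xp => xp pz.
  right; apply/existsP; exists (last x p); rewrite adj_sym pz /=.
  by apply/dist_leP; exists p.
- by exists p; split=> //; apply: leqW.
- case/existsP => z /andP[yz /dist_leP[p [pq xp pz]]].
  exists (rcons p y); rewrite size_rcons rcons_path last_rcons pz adj_sym xp.
  by split.
Qed.

Lemma dist_le_sym q x y : dist_le q x y = dist_le q y x.
Proof.
suff imp : forall u v : G, dist_le q u v -> dist_le q v u by apply/idP/idP => /imp.
move=> u v /dist_leP[p [pq up <-]]; apply/dist_leP.
exists (rev (belast u p)); split; first by rewrite size_rev size_belast.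
  by rewrite rev_path; move: up; congr is_true; apply: eq_path => a b; rewrite adj_sym.
by case: p {pq up} => //= z p; rewrite rev_cons last_rcons.
Qed.

(** Count ordered adjacent pairs and sort them by their edge: over the edge of [x] and [y] only
    [(x, y)] and [(y, x)] occur. *)
Lemma sum_degrees (vs : seq G) (nb : G -> seq G) :
  adjacency_lists vs nb -> \sum_(v <- vs) size (nb v) <= 2 * #|edges G|.
Proof.
case=> vs_uniq vs_all nb_uniq nb_adj.
pose arcs := [set p : G * G | adj p.1 p.2].
have -> : \sum_(v <- vs) size (nb v) = #|arcs|.
  rewrite -sum1_card (eq_bigl (fun p => predT p.1 && adj p.1 p.2)); last first.
    by move=> p; rewrite inE.
  rewrite -(pair_big_dep predT (@adj G) (fun _ _ => 1)) /=.
  rewrite big_uniq //= (eq_bigl predT) => [|v]; last exact: vs_all.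
  apply: eq_bigr => v _; rewrite sum1_card -(card_uniqP (nb_uniq v)).
  by apply: eq_card => u; rewrite nb_adj.
pose f (p : G * G) := [set p.1; p.2].
rewrite -sum1_card (partition_big f (mem (edges G))) /=; last first.
  by move=> p; rewrite inE => p_adj; apply/imsetP; exists p; rewrite ?inE.
rewrite mulnC -sum_nat_const; apply: leq_sum => e /imsetP[[x y] _ ->].
rewrite sum1_card; apply: (@leq_trans #|[set (x, y); (y, x)]|); last first.
  by rewrite cards2; case: eqP.
apply/subset_leq_card/subsetP => -[a b]; rewrite !inE /f /= => /andP[ab /eqP E].
have ax : a \in [set x; y] by rewrite -E !inE eqxx.
have bx : b \in [set x; y] by rewrite -E !inE eqxx orbT.
move: ax bx ab; rewrite !inE !xpair_eqE.
by case/orP => /eqP-> /orP[] /eqP->; rewrite ?eqxx ?orbT ?adj_irr.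
Qed.
End Distance.

Lemma nth_flatten_prefix (T : Type) (x0 : T) (ss : seq (seq T)) k l :
    l < size (nth [::] ss k) ->
  nth x0 (flatten ss) (sumn (take k (map size ss)) + l) = nth x0 (nth [::] ss k) l.
Proof.
elim: ss k => [|s ss IH] [|k] //= l_lt; rewrite nth_cat ?l_lt //.
by rewrite -addnA ltnNge leq_addr /= addKn IH.
Qed.

(** * Programs with time bounds *)

(** Halting, step bound and postcondition are kept in one statement, so that budgets compose
    together with correctness. *)
Definition wp (p : prog) (m : state) (T : nat) (Q : state -> Prop) : Prop :=
  exists m' t, [/\ exec p m m' t, t <= T & Q m'].

Lemma wp_le p m (T T' : nat) (Q : state -> Prop) : T <= T' -> wp p m T Q -> wp p m T' Q.
Proof. by move=> TT' [m' [t [e tT q]]]; exists m', t; rewrite (leq_trans tT). Qed.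

Lemma wp_conseq p m T (Q Q' : state -> Prop) :
  (forall m', Q m' -> Q' m') -> wp p m T Q -> wp p m T Q'.
Proof. by move=> QQ' [m' [t [e tT /QQ' q]]]; exists m', t. Qed.

Lemma wp_instr c m (Q : state -> Prop) : Q (step c m) -> wp (Instr c) m 1 Q.
Proof. by move=> q; exists (step c m), 1; split => //; constructor. Qed.

Lemma wp_seq p1 p2 m T1 T2 (Q : state -> Prop) :
  wp p1 m T1 (fun m' => wp p2 m' T2 Q) -> wp (Seq p1 p2) m (T1 + T2) Q.
Proof.
move=> [m1 [t1 [e1 l1 [m2 [t2 [e2 l2 q]]]]]].
by exists m2, (t1 + t2); split=> //; [apply: ExecSeq e1 e2|apply: leq_add].
Qed.

Lemma wp_instr_seq c p m T (Q : state -> Prop) :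
  wp p (step c m) T Q -> wp (Seq (Instr c) p) m T.+1 Q.
Proof. by move=> w; rewrite -add1n; apply/wp_seq/wp_instr. Qed.

Lemma wp_if b p1 p2 m T (Q : state -> Prop) :
  (holds b m -> wp p1 m T Q) -> (~~ holds b m -> wp p2 m T Q) ->
  wp (If b p1 p2) m T.+1 Q.
Proof.
move=> w1 w2; case: (boolP (holds b m)) => [hb|hb].
  by have [m' [t [e l q]]] := w1 hb; exists m', t.+1; split=> //; apply: ExecIfTrue.
by have [m' [t [e l q]]] := w2 hb; exists m', t.+1; split=> //; apply: ExecIfFalse.
Qed.

(** The budget [T k] may vary with the round, so that inner loops over adjacency lists add up to the
    sum of the degrees. Each round pays one step for its test; the outermost successor is the
    failing test. *)
Lemma wp_while (I : nat -> state -> Prop) b p N (T : nat -> nat) m (Q : state -> Prop) :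
    I 0 m ->
    (forall k m, k < N -> I k m -> holds b m /\ wp p m (T k) (I k.+1)) ->
    (forall m, I N m -> ~~ holds b m /\ Q m) ->
  wp (While b p) m (\sum_(k < N) (T k).+1).+1 Q.
Proof.
move=> I0 body stop.
suff loop d k m' : k + d = N -> I k m' ->
    wp (While b p) m' (\sum_(k <= i < N) (T i).+1).+1 Q.
  by have := loop N 0 m erefl I0; rewrite big_mkord.
elim: d k m' => [|d IH] k m' kd Ik.
  rewrite addn0 in kd; subst k; have [nb q] := stop _ Ik.
  by exists m', 1; split=> //; constructor.
have kN : k < N by lia.
have [hb [m1 [t1 [e1 l1 I1]]]] := body _ _ kN Ik.
have [|m2 [t2 [e2 l2 q]]] := IH k.+1 m1 _ I1; first by lia.
exists m2, (t1 + t2).+1; split=> //; first exact: ExecWhileTrue e1 e2.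
by rewrite big_ltn //; lia.
Qed.

Lemma wp_while_const (I : nat -> state -> Prop) b p N T m (Q : state -> Prop) :
    I 0 m ->
    (forall k m, k < N -> I k m -> holds b m /\ wp p m T (I k.+1)) ->
    (forall m, I N m -> ~~ holds b m /\ Q m) ->
  wp (While b p) m (N * T.+1).+1 Q.
Proof.
move=> I0 body stop.
by have := wp_while (T := fun=> T) I0 body stop; rewrite sum_nat_const card_ord.
Qed.

Definition frame (l : seq nat) (m m' : state) : Prop :=
  forall x, x \notin l -> reg m' x = reg m x.

Lemma frame_trans l m1 m2 m3 : frame l m1 m2 -> frame l m2 m3 -> frame l m1 m3.
Proof. by move=> f12 f23 x xl; rewrite f23 // f12. Qed.

Lemma frame_sub (l l' : seq nat) m m' :
  {subset l <= l'} -> frame l m m' -> frame l' m m'.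
Proof. by move=> ll' f x xl'; apply: f; apply: contra xl' => /ll'. Qed.

Lemma frame_set l m m' x v : x \in l -> frame l m m' -> frame l m (set_reg m' x v).
Proof.
by move=> xl f y yl; rewrite /= /upd; case: eqP yl => [->|_ yl]; [rewrite xl|apply: f].
Qed.

(** Register 0, the number of vertices, and register 1, which stays 0, are left out. *)
Definition scratch : seq nat := [:: 2; 3; 4; 5; 6; 7; 8; 9].

Lemma upd_same (T : Type) (g : nat -> T) i v : upd g i v i = v.
Proof. by rewrite /upd eqxx. Qed.

Lemma upd_other (T : Type) (g : nat -> T) i v j : j != i -> upd g i v j = g j.
Proof. by rewrite /upd => /negPf->. Qed.

Definition skip : prog := Instr (IConst 8 0).

(* Register 2 is the loop counter, 8 is zero and 7 is the flag that survives
   while every array of the list has the polarity [pol] at the counter. *)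
Fixpoint check (pol : bool) (As : seq nat) : prog :=
  if As is A :: As' then
    Seq (Instr (ILoad 6 A 2))
      (Seq (if pol then If (TEq 6 8) (Instr (IConst 7 0)) skip
            else If (TEq 6 8) skip (Instr (IConst 7 0)))
         (check pol As'))
  else skip.

(** An array is read as the characteristic function of a set of vertices, in use a ball; [pol]
    selects membership or non-membership. *)
Definition lit (m : state) (pol : bool) (v A : nat) : bool :=
  (arr m A v != 0) == pol.

Lemma wp_check pol As m :
    reg m 8 = 0 ->
  wp (check pol As) m (3 * size As).+1 (fun m' =>
    [/\ arr m' = arr m, frame [:: 6; 7; 8] m m', reg m' 8 = 0 &
        (reg m' 7 != 0) = (reg m 7 != 0) && all (lit m pol (reg m 2)) As]).
Proof.
elim: As m => [|A As IH] m m8 /=.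
  apply: wp_instr; split=> //=; last by rewrite andbT.
  by move=> x; rewrite !inE /= /upd => /norP[_ /norP[_ /negPf->]].
apply: (@wp_le _ _ (2 + (3 * size As).+1).+1); first by lia.
apply: wp_instr_seq => /=.
set m1 := set_reg _ _ _.
have f1 : frame [:: 6; 7; 8] m m1.
  by move=> x; rewrite !inE /m1 /= /upd => /norP[/negPf-> _].
suff step7 : wp (if pol then If (TEq 6 8) (Instr (IConst 7 0)) skip
            else If (TEq 6 8) skip (Instr (IConst 7 0))) m1 2
    (fun m' => [/\ arr m' = arr m, frame [:: 6; 7; 8] m m', reg m' 8 = 0 &
        (reg m' 7 != 0) = (reg m 7 != 0) && lit m pol (reg m 2) A]).
  apply/wp_seq; apply: wp_conseq step7.
  move=> m2 [a2 f2 z2 e2]; apply: wp_conseq (IH m2 z2).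
  move=> m3 [a3 f3 z3 e3]; split => //; first by rewrite a3.
    exact: frame_trans f2 f3.
  by rewrite e3 e2 -andbA /lit a2 f2.
case: pol {IH}; apply: wp_if => /=; rewrite /upd /= m8 => hv;
  apply: wp_instr; split; try exact: frame_set; rewrite //= /upd /= /lit /= ?m8 //.
- by rewrite (eqP hv) andbF.
- by rewrite hv andbT.
- by rewrite (eqP hv) andbT.
- by rewrite hv andbF.
Qed.

(* Registers from 10 on hold the variables of the formula; in this unary form,
   comparisons with the scratch registers compute. *)
Notation vreg x := (x.+4.+4.+2).

(** The scan has no early exit, so its number of rounds is fixed. Register 9 reports success; [x]
    ends with the last vertex found, or keeps its old value and thus remains a valid vertex
    number. *)
Definition search (pol : bool) (As : seq nat) (x : nat) : prog :=
  Seq (Instr (IConst 9 0)) (Seq (Instr (IConst 8 0)) (Seq (Instr (IConst 2 0))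
    (While (TLt 2 0)
      (Seq (Instr (IConst 7 1)) (Seq (check pol As)
        (Seq (If (TEq 7 8) skip (Seq (Instr (IMove x 2)) (Instr (IConst 9 1))))
           (Instr (ISucc 2 2)))))))).

Lemma wp_search pol As x m :
  wp (search pol As (vreg x)) m (reg m 0 * (3 * size As + 7) + 4) (fun m' =>
    [/\ arr m' = arr m, frame ((vreg x) :: scratch) m m', reg m' 8 = 0 &
        if reg m' 9 == 0 then
          reg m' (vreg x) = reg m (vreg x) /\
          (forall v, v < reg m 0 -> ~~ all (lit m pol v) As)
        else reg m' (vreg x) < reg m 0 /\ all (lit m pol (reg m' (vreg x))) As]).
Proof.
apply: (@wp_le _ _ (reg m 0 * (3 * size As + 6).+1).+4); first by lia.
do 3!apply: wp_instr_seq.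
pose I k m' := [/\ arr m' = arr m, frame ((vreg x) :: scratch) m m', reg m' 8 = 0,
  reg m' 2 = k &
  if reg m' 9 == 0 then
    reg m' (vreg x) = reg m (vreg x) /\ (forall v, v < k -> ~~ all (lit m pol v) As)
  else reg m' (vreg x) < reg m 0 /\ all (lit m pol (reg m' (vreg x))) As].
apply: (wp_while_const (I := I)) => [|k m' kn [a f z c fd]|m' [a f z c fd]].
- by split=> //=; do 3!apply: frame_set => //.
- have m'0 : reg m' 0 = reg m 0 by apply: f.
  split; first by rewrite /= c m'0.
  apply: (@wp_le _ _ ((3 * size As).+1 + (3 + 1)).+1); first by lia.
  apply: wp_instr_seq; apply: wp_seq.
  apply: wp_conseq (wp_check _ _ _) => //= m1 [a1 f1 z1 e1].
  have r1 y : y \notin [:: 6; 7; 8] -> reg m1 y = reg m' y.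
    by move=> yl; rewrite f1 //= upd_other //; apply: contra yl => /eqP->.
  have all1 v : all (lit (set_reg m' 7 1) pol v) As = all (lit m pol v) As.
    by apply: eq_all => A; rewrite /lit /= a.
  rewrite {}all1 /= upd_other // c in e1.
  have {}f1 : frame (vreg x :: scratch) m m1.
    apply: frame_trans (frame_sub _ f1) => [|y]; first exact: frame_set.
    by rewrite !inE => /or3P[] ->; rewrite ?orbT.
  have a1' : arr m1 = arr m by rewrite a1.
  apply: wp_seq; apply: wp_if => /= hv.
    apply: wp_le (wp_instr _) => //; apply: wp_instr; split=> //=.
    + by do 2!apply: frame_set => //.
    + by rewrite /upd /= r1 // c.
    have nok : ~~ all (lit m pol k) As.
      by rewrite -e1 (eqP hv) z1.
    rewrite /upd /=; move: fd; rewrite !r1 //.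
    case: eqP => // _ [rx nv]; split=> // v; rewrite ltnS leq_eqVlt.
    by case/predU1P => [->|/nv].
  apply: (@wp_le _ _ 2) => //.
  apply: wp_instr_seq; apply: wp_instr; apply: wp_instr; split=> //=.
  + by do 3!apply: frame_set => //; rewrite mem_head.
  + by rewrite /upd /= r1 // c.
  rewrite /upd /= eqxx r1 // c; split=> //.
  by rewrite -e1; rewrite z1 in hv.
- by split; [rewrite /= c f // ltnn | split].
Qed.

(** * Computing balls *)

(** Offsets are described by their successive differences, which is how [round] walks along array
    1. *)
Definition stored (n : nat) (nbi : nat -> seq nat) (m : state) : Prop :=
  [/\ reg m 0 = n, arr m 0 0 = 0,
      (forall k, k < n -> arr m 0 k.+1 = arr m 0 k + size (nbi k)) &
      (forall k l, k < n -> l < size (nbi k) ->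
         arr m 1 (arr m 0 k + l) = nth 0 (nbi k) l)].

Definition same_arr_except (P : pred nat) (m m' : state) : Prop :=
  forall A, ~~ P A -> arr m' A = arr m A.

Lemma same_arr_set_arr (P : pred nat) m m' A i v : P A ->
  same_arr_except P m m' -> same_arr_except P m (set_arr m' A i v).
Proof.
by move=> PA mm' B PB; rewrite /= upd_other ?mm' //; apply: contra PB => /eqP->.
Qed.

Definition init (dst x : nat) : prog :=
  Seq (Instr (IConst 2 0)) (While (TLt 2 0)
    (Seq (If (TEq 2 x) (Instr (IConst 6 1)) (Instr (IConst 6 0)))
      (Seq (Instr (IStore dst 2 6)) (Instr (ISucc 2 2))))).

Lemma wp_init dst x m :
  wp (init dst (vreg x)) m (reg m 0 * 5 + 2) (fun m' =>
    [/\ same_arr_except (pred1 dst) m m', frame scratch m m' &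
        forall v, v < reg m 0 -> (arr m' dst v != 0) = (v == reg m (vreg x))]).
Proof.
apply: (@wp_le _ _ (reg m 0 * 5).+2); first by lia.
apply: wp_instr_seq.
pose I k m' := [/\ same_arr_except (pred1 dst) m m', frame scratch m m',
  reg m' 2 = k &
  forall v, v < k -> (arr m' dst v != 0) = (v == reg m (vreg x))].
apply: (wp_while_const (I := I)) => [|k m' kn [a f c h]|m' [a f c h]].
- by split=> //=; apply: frame_set.
- split; first by rewrite /= c f.
  apply: (@wp_le _ _ (2 + 2)) => //; apply: wp_seq.
  suff cont (b : bool) : (k == reg m (vreg x)) = b ->
      wp (Seq (Instr (IStore dst 2 6)) (Instr (ISucc 2 2))) (set_reg m' 6 b) 2 (I k.+1).
    by apply: wp_if; rewrite /= c f // => hv; apply: wp_instr;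
      [apply: (cont true)|apply: (cont false); apply: negbTE].
  move=> kb; apply: wp_instr_seq; apply: wp_instr; split.
  + by apply: same_arr_set_arr => //=.
  + by do 2!apply: frame_set => //.
  + by rewrite /= /upd /= c.
  move=> v; rewrite ltnS leq_eqVlt /= upd_same /upd /= c.
  by case/predU1P => [->|vk]; [rewrite eqxx kb; case: (b)|rewrite (ltn_eqF vk) h].
- by rewrite /= c f // ltnn; split.
Qed.

(** Register 3 is a cursor into the concatenated lists that is never reset: each inner loop stops at
    the offset of the next vertex. Hence a round is linear in vertices plus list entries. *)
Definition round (src dst : nat) : prog :=
  Seq (Instr (IConst 2 0)) (Seq (Instr (IConst 3 0)) (Seq (Instr (IConst 8 0))
    (While (TLt 2 0)
      (Seq (Instr (ILoad 6 src 2)) (Seq (Instr (IStore dst 2 6))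
        (Seq (Instr (ISucc 5 2)) (Seq (Instr (ILoad 4 0 5))
          (Seq
            (While (TLt 3 4)
              (Seq (Instr (ILoad 5 1 3)) (Seq (Instr (ILoad 6 src 5))
                (Seq (If (TEq 6 8) skip (Instr (IStore dst 2 6)))
                   (Instr (ISucc 3 3))))))
            (Instr (ISucc 2 2)))))))))).

Lemma wp_round n nbi src dst m :
    stored n nbi m -> src != dst.+2 ->
  wp (round src dst.+2) m (7 * n + 6 * (\sum_(k < n) size (nbi k)) + 4) (fun m' =>
    [/\ same_arr_except (pred1 dst.+2) m m', frame scratch m m' &
        forall v, v < n -> (arr m' dst.+2 v != 0) =
          (arr m src v != 0) || has (fun u => arr m src u != 0) (nbi v)]).
Proof.
move=> [m0 off0 offS lists] srcdst.
pose f v := (arr m src v != 0) || has (fun u => arr m src u != 0) (nbi v).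
pose I k m' := [/\ same_arr_except (pred1 dst.+2) m m', frame scratch m m',
  [/\ reg m' 2 = k, reg m' 3 = arr m 0 k & reg m' 8 = 0] &
  forall v, v < k -> (arr m' dst.+2 v != 0) = f v].
apply: (@wp_le _ _ (\sum_(k < n) (6 * size (nbi k) + 6).+1).+4).
  rewrite big_distrr /= (eq_bigr (fun k : 'I_n => 6 * size (nbi k) + 7)).
    by rewrite big_split /= sum_nat_const card_ord; lia.
  by move=> k _; lia.
do 3!apply: wp_instr_seq.
apply: (wp_while (I := I) (T := fun k => 6 * size (nbi k) + 6)).
- by split=> //=; do 3!apply: frame_set => //.
- move=> k m1 kn [a1 f1 [r2 r3 r8] h1]; split; first by rewrite /= r2 f1 // m0.
  apply: (@wp_le _ _ ((size (nbi k) * 6).+1 + 1).+4); first by lia.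
  do 4!apply: wp_instr_seq.
  pose J l m' := [/\ same_arr_except (pred1 dst.+2) m m', frame scratch m m',
    [/\ reg m' 2 = k, reg m' 3 = arr m 0 k + l, reg m' 8 = 0 &
        reg m' 4 = arr m 0 k.+1],
    (forall v, v < k -> (arr m' dst.+2 v != 0) = f v) &
    (arr m' dst.+2 k != 0) =
      (arr m src k != 0) || has (fun u => arr m src u != 0) (take l (nbi k))].
  apply: wp_seq; apply: (wp_while_const (I := J)).
  + split.
    * by apply: same_arr_set_arr => //=.
    * by do 4!apply: frame_set => //.
    * by rewrite /= /upd /= r2 r3 addn0; split=> //; rewrite a1.
    * by move=> v vk; rewrite /= upd_same /upd /= r2 (ltn_eqF vk) h1.
    * by rewrite /= upd_same /upd /= r2 eqxx take0 /= orbF a1 // inE.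
  + move=> l m2 ld [a2 f2 [q2 q3 q8 q4] h2 hk]; split.
      by rewrite /= q3 q4 offS // ltn_add2l.
    have u_eq : arr m2 1 (reg m2 3) = nth 0 (nbi k) l by rewrite a2 // q3 lists.
    have s_eq : arr m2 src = arr m src by rewrite a2.
    have tk : take l.+1 (nbi k) = rcons (take l (nbi k)) (nth 0 (nbi k) l).
      by rewrite (take_nth 0).
    apply: (@wp_le _ _ (2 + 1).+2) => //; do 2!apply: wp_instr_seq.
    apply: wp_seq; apply: wp_if; rewrite /= /upd /= q8 u_eq s_eq => hv;
      do 2!apply: wp_instr; split.
    * by [].
    * by do 4!apply: frame_set => //.
    * by rewrite /= /upd /= q3 addnS.
    * by [].
    * by rewrite /= hk tk has_rcons (eqP hv) /=.
    * by apply: same_arr_set_arr => //=.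
    * by do 3!apply: frame_set => //.
    * by rewrite /= /upd /= q3 addnS.
    * by move=> v vk; rewrite /= upd_same /upd /= q2 (ltn_eqF vk) h2.
    * rewrite /= upd_same /upd /= q2 eqxx tk has_rcons hv orbT.
      by [].
  + move=> m2 [a2 f2 [q2 q3 q8 q4] h2 hk].
    split; first by rewrite /= q3 q4 offS // ltnn.
    apply: wp_instr; split => //.
    * by apply: frame_set.
    * by rewrite /= /upd /= q2 q3 q8 offS.
    * move=> v; rewrite ltnS leq_eqVlt => /predU1P[->|/h2] //=.
      by rewrite hk take_size.
- by move=> m' [a' f' [r2 _ _] h]; rewrite /= r2 f' // m0 ltnn; split.
Qed.

Lemma stored_preserved n nbi (P : pred nat) m m' :
    (forall A, P A -> 1 < A) -> same_arr_except P m m' -> reg m' 0 = reg m 0 ->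
  stored n nbi m -> stored n nbi m'.
Proof.
move=> P_gt1 mm' r0 [m0 off0 offS lists].
have nP A : A < 2 -> ~~ P A by apply: contraL => /P_gt1; rewrite -leqNgt.
by split; rewrite ?r0 // ?[arr m' 0]mm' ?[arr m' 1]mm' ?nP.
Qed.

(** Each radius has its own array, since [round] must not overwrite what it reads; the shift by 2
    spares the arrays of the graph. *)
Fixpoint ball (g : nat -> nat) (q x : nat) : prog :=
  if q is q'.+1 then Seq (ball g q' x) (round (g q').+2 (g q).+2)
  else init (g 0).+2 x.

(** * Balls for the atoms of a formula *)

Section Program.
Variables s t : nat.

Definition rg (i : 'I_s + 'I_t) : nat := vreg (pickle i).

(* The array of the ball of radius [l] used for the atom [x]; the index [o] is
   [None] for the current candidate and [Some j] for the [j]-th counterexample. *)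
Definition aid (o : option nat) (x : atom s t) (l : nat) : nat := pickle (o, x, l).

(** For a fixed candidate a violating [y] is sought, so its balls are around the [x]; a
    counterexample constrains the later [x], so its balls are around the [y]. *)
Definition center_var (o : option nat) (x : atom s t) : 'I_s + 'I_t :=
  if o is Some _ then inr x.2.2 else inl x.2.1.

Definition balls (o : option nat) (xs : seq (atom s t)) : prog :=
  foldr (fun x p => Seq (ball (aid o x) x.1 (rg (center_var o x))) p) skip xs.

(** The index is decoded from the array number, so different indices own disjoint sets of arrays,
    none of them among the input arrays 0 and 1. *)
Definition own (o : option nat) (A : nat) : bool :=
  (1 < A) && (if @unpickle (option nat * atom s t * nat)%type A.-2 is Some (o', _, _)
              then o' == o else false).

Lemma own_aid o o' x l : own o (aid o' x l).+2 = (o' == o).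
Proof. by rewrite /own /= pickleK. Qed.

Lemma aid_inj o x x' l l' : aid o x l = aid o x' l' -> x = x' /\ l = l'.
Proof. by move=> /(pcan_inj pickleK) [-> ->]. Qed.

Variables (G : sgraph) (vs : seq G) (nb : G -> seq G) (x0 : G) (sz : nat).
Hypothesis Gvs : adjacency_lists vs nb.
Hypothesis sz_ge : maxn 1 (gsize G) <= sz.

Local Notation n := (size vs).
Local Notation vtx := (nth x0 vs).
Definition nbi (k : nat) : seq nat := [seq index u vs | u <- nb (vtx k)].

Lemma size_vs : n = #|G|.
Proof.
case: Gvs => vs_uniq vs_all _ _; rewrite -(card_uniqP vs_uniq).
by apply: eq_card => v; rewrite vs_all.
Qed.

Lemma n_le_sz : n <= sz.
Proof.
by apply: leq_trans sz_ge; rewrite leq_max size_vs /gsize leq_addr orbT.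
Qed.

Lemma sz_gt0 : 0 < sz. Proof. by apply: leq_trans sz_ge; rewrite leq_max. Qed.

Lemma sum_nbi : \sum_(k < n) size (nbi k) <= 2 * sz.
Proof.
apply: (@leq_trans (\sum_(v <- vs) size (nb v))).
  rewrite (big_nth x0) big_mkord; apply: eq_leq.
  by apply: eq_bigr => k _; rewrite size_map.
apply: leq_trans (sum_degrees Gvs) _; rewrite leq_mul2l /=.
by apply: leq_trans sz_ge; rewrite leq_max /gsize leq_addl orbT.
Qed.

Lemma vtx_index u : vtx (index u vs) = u.
Proof. by case: Gvs => _ vs_all _ _; rewrite nth_index. Qed.

Lemma index_vtx k : k < n -> index (vtx k) vs = k.
Proof. by case: Gvs => vs_uniq _ _ _ kn; rewrite index_uniq. Qed.

Lemma index_lt u : index u vs < n.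
Proof. by case: Gvs => _ vs_all _ _; rewrite index_mem. Qed.

Lemma wp_ball g q x m :
    injective g -> stored n nbi m -> reg m (vreg x) < n ->
  wp (ball g q (vreg x)) m (q.+1 * (23 * sz)) (fun m' =>
    [/\ same_arr_except (fun A => A \in [seq (g l).+2 | l <- iota 0 q.+1]) m m',
        frame scratch m m' &
        forall v, v < n ->
          (arr m' (g q).+2 v != 0) = dist_le q (vtx (reg m (vreg x))) (vtx v)]).
Proof.
have n_le := n_le_sz; have sz0 := sz_gt0; have sum_le := sum_nbi.
move=> g_inj st xn; elim: q => [|q IH]; rewrite [ball _ _ _]/=.
  apply: (@wp_le _ _ (reg m 0 * 5 + 2)); first by case: st => ->; lia.
  apply: wp_conseq (wp_init _ _ _) => m' [a f h]; split=> //.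
    by move=> A /= hA; apply: a; apply: contra hA => /eqP->; rewrite mem_head.
  case: st => m0 _ _ _ v vn; rewrite h ?m0 // dist_le0.
  by apply/eqP/eqP => [->//|/(congr1 (index^~ vs))]; rewrite !index_vtx.
apply: (@wp_le _ _ (q.+1 * (23 * sz) + 23 * sz)); first by rewrite -mulSnr.
apply: wp_seq; apply: wp_conseq IH => m1 [a1 f1 h1].
have st1 : stored n nbi m1.
  by apply: stored_preserved a1 _ st => [A /mapP[l _ ->]//|]; apply: f1.
(* With [n <= sz], at most [2 * sz] list entries and [0 < sz], this is at most
   [(7 + 12 + 4) * sz]. *)
apply: (@wp_le _ _ (7 * n + 6 * (\sum_(k < n) size (nbi k)) + 4)).
  by move: sum_le; set S := \sum_(_ < _) _; lia.
apply: wp_conseq (wp_round st1 _); last first.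
  by rewrite !eqSS; apply/eqP => /g_inj /eqP; rewrite ltn_eqF.
move=> m2 [a2 f2 h2]; split.
- move=> A hA; rewrite a2; last first.
    apply: contra hA => /eqP->; apply: (map_f (fun l => (g l).+2)).
    by rewrite mem_iota ltnSn.
  apply: a1; apply: contra hA => /mapP[l]; rewrite mem_iota => /andP[_ lq] ->.
  by apply: (map_f (fun l => (g l).+2)); rewrite mem_iota; apply: leqW.
- exact: frame_trans f1 f2.
move=> v vn; rewrite h2 // h1 // dist_leS; congr (_ || _).
rewrite /nbi has_map; case: (Gvs) => _ _ _ nb_adj.
apply/hasP/existsP => [[u unb /= hu]|[u /andP[uadj hu]]]; exists u.
  by rewrite -nb_adj unb -[u in dist_le _ _ u]vtx_index -h1 ?index_lt.
  by rewrite nb_adj.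
by rewrite /= h1 ?index_lt // vtx_index.
Qed.

(** The centres are given as vertices and not by registers, because the registers change in later
    searches while the arrays persist. *)
Definition ball_correct (o : option nat) (c : atom s t -> G) (m : state) (x : atom s t) :=
  forall v, v < n -> (arr m (aid o x x.1).+2 v != 0) = dist_le x.1 (c x) (vtx v).

(** The disjunct for balls that are already correct carries the induction: the ball of the head atom
    must survive the work for the tail, and distinct atoms use disjoint arrays. *)
Lemma wp_balls r o xs c m :
    stored n nbi m -> (forall i, reg m (rg i) < n) ->
    (forall x, x \in xs -> x.1 <= r) ->
    (forall x, x \in xs -> c x = vtx (reg m (rg (center_var o x)))) ->
  wp (balls o xs) m ((size xs * (r.+1 * 23)).+1 * sz) (fun m' =>
    [/\ same_arr_except (own o) m m', frame scratch m m' &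
        forall x, x \in xs \/ ball_correct o c m x -> ball_correct o c m' x]).
Proof.
have sz0 := sz_gt0.
elim: xs m => [|x xs IH] m st m_var xs_r xs_c /=.
  rewrite mul1n; apply: wp_le sz0 _; apply: wp_instr; split=> //.
    exact: frame_set.
  by move=> x [].
apply: (@wp_le _ _ (r.+1 * (23 * sz) + (size xs * (r.+1 * 23)).+1 * sz)).
  by rewrite mulnA -mulnDl addnS -mulSn.
apply: wp_seq.
have xr : x.1 <= r by apply: xs_r; rewrite mem_head.
apply: (@wp_le _ _ (x.1.+1 * (23 * sz))); first by rewrite leq_mul2r ltnS xr orbT.
apply: wp_conseq (wp_ball _ _ st (m_var _)); last first.
  by move=> l l' /aid_inj[].
move=> m1 [a1 f1 h1].
have rg1 i : reg m1 (rg i) = reg m (rg i) by apply: f1.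
have a1' : same_arr_except (own o) m m1.
  move=> A nA; apply: a1; apply: contra nA => /mapP[l _ ->].
  by rewrite own_aid.
have st1 : stored n nbi m1.
  by apply: stored_preserved a1' _ st => [A /andP[]//|]; apply: f1.
apply: wp_conseq (IH m1 st1 _ _ _) => [m2 [a2 f2 h2]|i|y yxs|y yxs].
- split.
  + by move=> A nA; rewrite a2 // a1'.
  + exact: frame_trans f1 f2.
  move=> y hy; apply: h2; rewrite inE in hy.
  have [->|yx] := eqVneq y x.
    by right=> v vn; rewrite h1 // xs_c // mem_head.
  rewrite (negPf yx) /= in hy; case: hy => [|hy]; [by left|right] => v vn.
  rewrite a1 ?hy //; apply/negP => /mapP[l _ [/aid_inj[/eqP]]].
  by rewrite (negPf yx).
- by rewrite rg1.
- by apply: xs_r; rewrite inE yxs orbT.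
- by rewrite rg1; apply: xs_c; rewrite inE yxs orbT.
Qed.

(** * Searching for candidates and counterexamples *)

Definition good (m : state) : Prop := stored n nbi m /\ forall i, reg m (rg i) < n.

(** A conjunction of literals, each pairing one variable with the array of a ball around a fixed
    vertex. As no literal links two variables, each variable can be searched for independently. *)
Definition task : Type := seq (('I_s + 'I_t) * nat).

Definition task_sat (m : state) (pol : bool) (f : 'I_s + 'I_t -> nat) (w : task) :=
  all (fun l => lit m pol (f l.1) l.2) w.

Definition lits (w : task) (i : 'I_s + 'I_t) : seq nat :=
  [seq l.2 | l <- w & l.1 == i].

Fixpoint try_vars (pol : bool) (w : task) (js : seq ('I_s + 'I_t)) (yes no : prog) : prog :=
  if js is i :: js' then
    Seq (search pol (lits w i) (rg i)) (If (TEq 9 8) no (try_vars pol w js' yes no))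
  else yes.

(** Continuation style: the text of [yes] is copied for every task, but a run executes a single
    continuation, so its cost is counted once. *)
Definition find (pol : bool) (ws : seq task) (yes no : prog) : prog :=
  foldr (fun w no' => try_vars pol w (unzip1 w) yes no') no ws.

Lemma rg_inj : injective rg.
Proof. by move=> i j [/(pcan_inj pickleK)]. Qed.

Lemma wp_try_vars pol w js yes no m T (Q : state -> Prop) :
    good m ->
    (forall m', good m' -> arr m' = arr m ->
       (forall i, i \in js \/ all (lit m pol (reg m (rg i))) (lits w i) ->
          all (lit m pol (reg m' (rg i))) (lits w i)) ->
       wp yes m' T Q) ->
    (forall m', good m' -> arr m' = arr m ->
       (exists i, forall v, v < n -> ~~ all (lit m pol v) (lits w i)) ->
       wp no m' T Q) ->
  wp (try_vars pol w js yes no) m (T + size js * ((3 * size w + 12) * sz)) Q.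
Proof.
have n_le := n_le_sz; have sz0 := sz_gt0.
elim: js m => [|i js IH] m gm hyes hno /=.
  by rewrite addn0; apply: hyes => // i [].
set c := (3 * size w + 12) * sz in IH *.
have c0 : 0 < c by rewrite muln_gt0 addn_gt0 orbT.
(* The step removed from [c] pays for the test of [If]; the constant 12 in [c] is [7 + 4] from
   [wp_search] plus this step. *)
apply: (@wp_le _ _ (c.-1 + (T + size js * c).+1)).
  by rewrite mulSn addnS -addSn prednK // addnCA.
have [[m0 _ _ _] m_var] := gm.
apply: wp_seq; apply: (@wp_le _ _ (reg m 0 * (3 * size (lits w i) + 7) + 4)).
  have : size (lits w i) <= size w by rewrite size_map size_filter count_size.
  by rewrite m0 /c; nia.
apply: wp_conseq (wp_search _ _ _ _) => m1 [a1 f1 z1 e1].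
have rg1 j : j != i -> reg m1 (rg j) = reg m (rg j).
  by move=> ji; apply: f1; rewrite inE negb_or (inj_eq rg_inj) ji.
have gm1 : good m1.
  split.
    apply: (@stored_preserved _ _ pred0 m) => //; last by case: gm.
      by move=> A _; rewrite a1.
    exact: f1.
  move=> j; have [->|/rg1->//] := eqVneq j i.
  by move: e1; case: ifP => _ [e _]; [rewrite e m_var|rewrite m0 in e].
have litE v A : lit m1 pol v A = lit m pol v A by rewrite /lit a1.
apply: wp_if => /=; rewrite z1 => hv.
  apply: wp_le (leq_addr _ _) _; apply: hno => //; exists i => v vn.
  by move: e1; rewrite hv m0 => -[_]; apply.
move: e1; rewrite (negPf hv) => -[_ ei].
apply: IH => // [m2 gm2 a2 h2|m2 gm2 a2 [j hj]].
- apply: hyes => //; first by rewrite a2.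
  move=> j hj; rewrite -(eq_all (litE _)); apply: h2.
  have [->|ji] := eqVneq j i; first by right; rewrite (eq_all (litE _)).
  move: hj; rewrite inE (negPf ji) rg1 // (eq_all (litE _)) /=.
  by case; [left|right].
- apply: hno => //; first by rewrite a2.
  by exists j => v vn; rewrite -(eq_all (litE _)) hj.
Qed.

Lemma task_sat_lits m pol f w i :
  task_sat m pol f w -> all (lit m pol (f i)) (lits w i).
Proof.
move=> /allP sat_w; apply/allP => A /mapP[l].
by rewrite mem_filter => /andP[/eqP <- lw] ->; apply: sat_w.
Qed.

Lemma lits_task_sat m pol f w :
  (forall i, i \in unzip1 w -> all (lit m pol (f i)) (lits w i)) -> task_sat m pol f w.
Proof.
move=> sat_w; apply/allP => l lw.
have /sat_w/allP : l.1 \in unzip1 w by apply: map_f.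
by apply; apply: map_f; rewrite mem_filter eqxx.
Qed.

(** A task of at most [b] literals causes at most [b] scans. If one scan fails, its variable has no
    admissible value, which rules out every assignment for that task. *)
Lemma wp_find pol ws yes no m T b (Q : state -> Prop) :
    good m -> (forall w, w \in ws -> size w <= b) ->
    (forall m' w, good m' -> arr m' = arr m -> w \in ws ->
       task_sat m pol (fun i => reg m' (rg i)) w -> wp yes m' T Q) ->
    (forall m', good m' -> arr m' = arr m ->
       (forall w f, w \in ws -> (forall i, f i < n) -> ~~ task_sat m pol f w) ->
       wp no m' T Q) ->
  wp (find pol ws yes no) m (T + size ws * (b * (3 * b + 12)) * sz) Q.
Proof.
elim: ws m => [|w ws IH] m gm wsb hyes hno /=.
  by rewrite addn0; apply: hno.
have wb : size w <= b by apply: wsb; rewrite mem_head.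
set c := b * (3 * b + 12) in IH *.
apply: (@wp_le _ _ ((T + size ws * c * sz) +
    size (unzip1 w) * ((3 * size w + 12) * sz))).
  rewrite size_map (mulSn (size ws)) (mulnDl c) -addnA leq_add2l [leqLHS]addnC leq_add2r.
  rewrite mulnA leq_mul2r.
  by apply/orP; right; rewrite /c leq_mul // leq_add2r leq_mul2l wb orbT.
have satE m1 f w' : arr m1 = arr m -> task_sat m1 pol f w' = task_sat m pol f w'.
  by rewrite /task_sat /lit => ->.
apply: wp_try_vars => // [m1 gm1 a1 h1|m1 gm1 a1 [i hi]].
  apply: wp_le (leq_addr _ _) _; apply: (hyes _ w) => //; first exact: mem_head.
  by apply: lits_task_sat => i iw; apply: h1; left.
apply: IH => // [w' w'ws|m2 w' gm2 a2 w'ws sat_w'|m2 gm2 a2 h2].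
- by apply: wsb; rewrite inE w'ws orbT.
- apply: (hyes _ w') => //; [by rewrite a2|by rewrite inE w'ws orbT|].
  by rewrite -(satE m1).
- apply: hno => //; first by rewrite a2.
  move=> w' f; rewrite inE => /predU1P[->|w'ws] fn.
    by apply: contra (hi (f i) (fn i)); apply: task_sat_lits.
  by rewrite -(satE m1) //; apply: h2.
Qed.

(** * Tasks from clauses, and the loop over counterexamples *)

Implicit Types (phi : dformula s t) (f : 'I_s + 'I_t -> nat).

Definition xs_of f : s.-tuple G := [tuple vtx (f (inl i)) | i < s].
Definition ys_of f : t.-tuple G := [tuple vtx (f (inr j)) | j < t].

Definition searched_var (o : option nat) (x : atom s t) : 'I_s + 'I_t :=
  if o is Some _ then inl x.2.1 else inr x.2.2.

Definition task_of (o : option nat) (D : seq (atom s t)) : task :=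
  [seq (searched_var o x, (aid o x x.1).+2) | x <- D].

(** Satisfying [phi] at all [j] counterexamples is a conjunction of [j] disjunctive normal forms;
    distributing, a task picks one clause for each counterexample. *)
Fixpoint candidate_tasks phi (j : nat) : seq task :=
  if j is j'.+1 then
    [seq task_of (Some j') D ++ w | D <- clauses phi true, w <- candidate_tasks phi j']
  else [:: [::]].

Definition violation_tasks phi : seq task :=
  [seq task_of None D | D <- clauses phi false].

(** Unrolling makes [j] a constant of the program text, and with it the array names. The branch
    without fuel is reached only with a ladder that contradicts the bound. *)
Fixpoint loop phi (fuel j : nat) : prog :=
  if fuel is fuel'.+1 then
    find true (candidate_tasks phi j)
      (Seq (balls None (atoms phi))
         (find false (violation_tasks phi)
            (Seq (balls (Some j) (atoms phi)) (loop phi fuel' j.+1))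
            (Instr (IConst 0 1))))
      (Instr (IConst 0 0))
  else Instr (IConst 0 0).

(** Measured in units of [sz], for [k] atoms of radius at most [r]: the balls of the candidate, the
    balls of the counterexample, the remaining iterations, the violation search and the candidate
    search. *)
Fixpoint loop_time (r k fuel j : nat) : nat :=
  if fuel is fuel'.+1 then
    (k * (r.+1 * 23)).+1
    + ((k * (r.+1 * 23)).+1 + loop_time r k fuel' j.+1 + 2 ^ k * (k * (3 * k + 12)))
    + (2 ^ k) ^ j * (j * k * (3 * (j * k) + 12))
  else 1.

Lemma size_candidate_tasks phi j :
  size (candidate_tasks phi j) <= (2 ^ fsize phi) ^ j.
Proof.
elim: j => [|j IH] //=; rewrite size_allpairs expnS leq_mul //.
exact: size_clauses.
Qed.

Lemma candidate_task_size phi j w :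
  w \in candidate_tasks phi j -> size w <= j * fsize phi.
Proof.
elim: j w => [|j IH] w /=; first by rewrite inE => /eqP->.
case/allpairsP => -[D w'] [/= /clauses_atoms[_ szD] /IH szw' ->].
by rewrite size_cat size_map mulSn leq_add.
Qed.

Lemma task_of_sat m pol f o D c :
    (forall i, f i < n) ->
    (forall x, x \in D -> ball_correct o c m x) ->
  task_sat m pol f (task_of o D) =
  all (fun x => dist_le x.1 (c x) (vtx (f (searched_var o x))) == pol) D.
Proof.
move=> fn; rewrite /task_sat /task_of all_map => hD.
by apply: eq_in_all => x xS; rewrite /= /lit hD.
Qed.

Lemma task_sat_cat m pol f w w' :
  task_sat m pol f (w ++ w') = task_sat m pol f w && task_sat m pol f w'.
Proof. exact: all_cat. Qed.

Definition balls_of phi m o c := forall x, x \in atoms phi -> ball_correct o c m x.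

Definition y_center (b : t.-tuple G) (x : atom s t) : G := tnth b x.2.2.
Definition x_center (a : s.-tuple G) (x : atom s t) : G := tnth a x.2.1.

Lemma candidate_task_of_sat phi m f j b D :
    (forall i, f i < n) -> balls_of phi m (Some j) (y_center b) ->
    {subset D <= atoms phi} ->
  task_sat m true f (task_of (Some j) D) = all (fun x => atom_sat (xs_of f) b x == true) D.
Proof.
move=> fn balls_b Dphi.
rewrite (task_of_sat _ fn (fun x xS => balls_b x (Dphi x xS))).
(* Symmetry enters because the balls are centred at [b], whereas atoms measure from the [x] side. *)
by apply: eq_all => x; rewrite /atom_sat tnth_mktuple dist_le_sym.
Qed.

Lemma violation_task_of_sat phi m f a D :
    (forall i, f i < n) -> balls_of phi m None (x_center a) ->
    {subset D <= atoms phi} ->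
  task_sat m false f (task_of None D) = all (fun x => atom_sat a (ys_of f) x == false) D.
Proof.
move=> fn balls_a Dphi.
rewrite (task_of_sat _ fn (fun x xS => balls_a x (Dphi x xS))).
by apply: eq_all => x; rewrite /atom_sat tnth_mktuple.
Qed.

Lemma candidate_tasksP phi m f j (bs : nat -> t.-tuple G) :
    positive phi -> (forall i, f i < n) ->
    (forall i, i < j -> balls_of phi m (Some i) (y_center (bs i))) ->
  (exists2 w, w \in candidate_tasks phi j & task_sat m true f w) <->
  (forall i, i < j -> sat phi (xs_of f) (bs i)).
Proof.
move=> pos fn; elim: j => [|j IH] balls_bs.
  by split=> // _; exists [::]; rewrite ?inE.
have [IH1 IH2] := IH (fun i ij => balls_bs i (leqW ij)).
split=> [[w /allpairsP[[D w'] [/= hD hw' ->]]]|hsat].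
  rewrite task_sat_cat => /andP[satD satw'] i.
  rewrite ltnS leq_eqVlt => /predU1P[->|ij]; last by apply: IH1 ij; exists w'.
  rewrite sat_evalf -[evalf _ _]eqb_id; apply/(clausesP _ _ pos); exists D => //.
  have [Dphi _] := clauses_atoms hD.
  by rewrite -(candidate_task_of_sat fn (balls_bs j (ltnSn j)) Dphi).
have [w' hw' satw'] := IH2 (fun i ij => hsat i (leqW ij)).
have := hsat j (ltnSn j); rewrite sat_evalf -[evalf _ _]eqb_id.
case/(clausesP _ _ pos) => D hD satD; have [Dphi _] := clauses_atoms hD.
exists (task_of (Some j) D ++ w'); first exact: allpairs_f.
rewrite task_sat_cat satw' andbT.
by rewrite (candidate_task_of_sat fn (balls_bs j (ltnSn j)) Dphi).
Qed.

Lemma violation_tasksP phi m f a :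
    positive phi -> (forall i, f i < n) -> balls_of phi m None (x_center a) ->
  (exists2 w, w \in violation_tasks phi & task_sat m false f w) <->
  ~~ sat phi a (ys_of f).
Proof.
move=> pos fn balls_a; rewrite sat_evalf -eqbF_neg.
split=> [[w /mapP[D hD ->]]|/(clausesP _ _ pos)[D hD]].
  have [Dphi _] := clauses_atoms hD.
  rewrite (violation_task_of_sat fn balls_a Dphi) => satD.
  by apply/(clausesP _ _ pos); exists D.
have [Dphi _] := clauses_atoms hD.
rewrite -(violation_task_of_sat fn balls_a Dphi) => satD.
by exists (task_of None D) => //; apply: map_f.
Qed.

(** Used for completeness: a search that fails for all numberings in range fails for all tuples. *)
Lemma assignment_of_tuples (a : s.-tuple G) (b : t.-tuple G) :
  exists f, [/\ forall i, f i < n, xs_of f = a & ys_of f = b].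
Proof.
exists (fun i => index (match i with inl i => tnth a i | inr j => tnth b j end) vs).
by split=> [i||]; rewrite ?index_lt //; apply: eq_from_tnth => i;
  rewrite tnth_mktuple vtx_index.
Qed.

Lemma good_preserved (P : pred nat) m m' :
    (forall A, P A -> 1 < A) -> same_arr_except P m m' -> frame scratch m m' ->
  good m -> good m'.
Proof.
move=> P_gt1 a f [st vars]; split; last by move=> i; rewrite f.
by apply: stored_preserved a _ st => //; apply: f.
Qed.

Lemma own_gt1 o A : own o A -> 1 < A.
Proof. by case/andP. Qed.

(** [L] is the history of pairs of candidate and counterexample. Only the balls of the
    counterexamples remain in memory; the candidates serve to keep [L] a ladder, whose bounded
    length ensures that the fuel suffices. *)
Lemma wp_loop r phi fuel (L : seq (s.-tuple G * t.-tuple G)) d m :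
    positive phi -> radius phi <= r ->
    (forall L' : seq (s.-tuple G * t.-tuple G), ladder phi L' -> size L' < size L + fuel) ->
    good m -> ladder phi L ->
    (forall i, i < size L -> balls_of phi m (Some i) (y_center (nth d L i).2)) ->
  wp (loop phi fuel (size L)) m (loop_time r (fsize phi) fuel (size L) * sz)
    (fun m' => (reg m' 0 != 0) <-> domination_problem phi G).
Proof.
move=> pos phi_r; elim: fuel L m => [|fuel IH] L m bounded gm ladL balls_L.
  by have := bounded L ladL; rewrite addn0 ltnn.
have sz0 := sz_gt0.
have atoms_r x : x \in atoms phi -> x.1 <= r.
  by move=> xphi; apply: leq_trans (atoms_radius xphi) phi_r.
rewrite [loop _ _ _]/= [loop_time _ _ _ _]/=.
set k := fsize phi; set B := (k * (r.+1 * 23)).+1.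
rewrite (mulnDl (B + _)).
have le_tasks (ws : seq task) b c : size ws <= c ->
    size ws * (b * (3 * b + 12)) * sz <= c * (b * (3 * b + 12)) * sz.
  by move=> wsc; rewrite !leq_mul2r wsc !orbT.
apply: wp_le (leq_add (leqnn _) (le_tasks _ _ _ (size_candidate_tasks _ _))) _.
apply: wp_find => // [w|m1 w gm1 a1 hw satw|m1 gm1 a1 hno].
- exact: candidate_task_size.
- pose f1 i := reg m1 (rg i); pose a := xs_of f1.
  have a_sat i : i < size L -> sat phi a (nth d L i).2.
    apply: (proj1 (@candidate_tasksP phi m f1 (size L) (fun i => (nth d L i).2)
      pos gm1.2 balls_L)).
    by exists w.
  have a_center x : x \in atoms phi ->
      x_center a x = vtx (reg m1 (rg (center_var None x))).
    by move=> _; rewrite /x_center tnth_mktuple.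
  have := wp_balls gm1.1 gm1.2 atoms_r a_center; rewrite size_atoms => wp_a.
  rewrite mulnDl; apply: wp_seq; apply: wp_conseq wp_a => m2 [a2 fr2 c2].
  have gm2 : good m2 := good_preserved (@own_gt1 None) a2 fr2 gm1.
  have balls_a : balls_of phi m2 None (x_center a) by move=> x xphi; apply: c2; left.
  rewrite (mulnDl (B + _)).
  have size_violation : size (violation_tasks phi) <= 2 ^ k.
    by rewrite size_map size_clauses.
  apply: wp_le (leq_add (leqnn _) (le_tasks _ _ _ size_violation)) _.
  apply: wp_find => // [w'|m3 w' gm3 a3 hw' satw'|m3 gm3 a3 hno].
  + by case/mapP => D /clauses_atoms[_ szD] ->; rewrite size_map.
  + pose f3 i := reg m3 (rg i); pose b := ys_of f3.
    have ab : ~~ sat phi a b.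
      by apply: (proj1 (violation_tasksP pos gm3.2 balls_a)); exists w'.
    have b_center x : x \in atoms phi ->
        y_center b x = vtx (reg m3 (rg (center_var (Some (size L)) x))).
      by move=> _; rewrite /y_center tnth_mktuple.
    have := wp_balls gm3.1 gm3.2 atoms_r b_center; rewrite size_atoms => wp_b.
    rewrite mulnDl; apply: wp_seq; apply: wp_conseq wp_b => m4 [a4 fr4 c4].
    have gm4 : good m4 := good_preserved (@own_gt1 _) a4 fr4 gm3.
    have := IH (rcons L (a, b)) m4; rewrite size_rcons; apply => //.
    * by move=> L' /bounded; rewrite addnS.
    (* The new [a] satisfies [phi] at all earlier counterexamples and fails at [b], so the ladder
       grows by one. *)
    * case: ladL => L_diag L_pair; split; first by rewrite all_rcons ab.
      rewrite pairwise_rcons L_pair andbT.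
      by apply/(all_nthP d) => i iL; apply: a_sat.
    move=> i; rewrite ltnS nth_rcons leq_eqVlt => /predU1P[->|iL] x xphi.
      by rewrite ltnn eqxx; apply: c4; left.
    (* The arrays written since then belong to [None] and [Some (size L)], so those of an earlier
       [Some i] are intact. *)
    rewrite iL => v vn; rewrite a4; last by rewrite own_aid eq_sym; apply/eqP => -[]; lia.
    by rewrite a3 a2 ?own_aid // a1; apply: balls_L.
  (* Without a violating [b], the candidate [a] is a solution. *)
  + apply: (@wp_le _ _ 1); first by rewrite addn_gt0 muln_gt0 sz0.
    apply: wp_instr; split => //= _; exists a => b.
    have [f [fn _ <-]] := assignment_of_tuples a b.
    apply: contraT => /(proj2 (violation_tasksP pos fn balls_a))[w' hw' satw'].
    by have := hno w' f hw' fn; rewrite satw'.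
(* A solution satisfies [phi] at every stored counterexample, so it would fulfil some candidate
   task. *)
- apply: (@wp_le _ _ 1).
    by rewrite muln_gt0 sz0 addn_gt0.
  apply: wp_instr; split => //= -[a a_dom].
  (* The tuple [(nth d L 0).2] merely fills the [y] half of the assignment. *)
  have [f [fn fa _]] := assignment_of_tuples a (nth d L 0).2.
  have [w hw satw] : exists2 w, w \in candidate_tasks phi (size L) & task_sat m true f w.
    apply: (proj2 (@candidate_tasksP phi m f (size L) (fun i => (nth d L i).2)
      pos fn balls_L)).
    by move=> i _; rewrite fa a_dom.
  by have := hno w f hw fn; rewrite satw.
Qed.

End Program.

(** * Input encoding, uniform bound, empty graph and conclusion *)

Lemma good_input (s t : nat) (G : sgraph) (vs : seq G) (nb : G -> seq G) (x0 : G) :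
  adjacency_lists vs nb -> @good s t G vs nb x0 (input vs nb).
Proof.
move=> Gvs; have [_ vs_all _ _] := Gvs.
have nth_off k : k <= size vs -> arr (input vs nb) 0 k =
    sumn (take k [seq size (nb v) | v <- vs]).
  move=> kn; rewrite -[arr _ _ _]/(nth 0 [seq sumn (take i [seq size (nb v) | v <- vs])
    | i <- iota 0 (size vs).+1] k).
  by rewrite (nth_map 0) ?size_iota ?ltnS // nth_iota.
(* The variable registers start at 0, a valid vertex number since [x0] exists. *)
split; last by move=> i; rewrite /= -has_predT; apply/hasP; exists x0.
split=> // [|k kn|k l kn].
- by rewrite nth_off // take0.
- rewrite !nth_off ?(ltnW kn) // (take_nth 0) ?size_map // sumn_rcons.
  by rewrite (nth_map x0) // size_map.
- have sizesE : [seq size (nb v) | v <- vs] =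
      map size [seq [seq index u vs | u <- nb v] | v <- vs].
    by rewrite -map_comp; apply: eq_map => v /=; rewrite size_map.
  rewrite nth_off ?(ltnW kn) // sizesE => l_lt /=.
  have nth_k : nth [::] [seq [seq index u vs | u <- nb v] | v <- vs] k = nbi vs nb x0 k.
    by rewrite (nth_map x0).
  by rewrite nth_flatten_prefix nth_k.
Qed.

(** The maximum of the finitely many bounds for [q <= r]. *)
Lemma uniform_semiladder_bound (r : nat) (C : sgraph -> Prop) :
    (forall q, q <= r -> finite_semiladder_index (delta_class q C)) ->
  exists M, forall G, C G -> forall q, q <= r -> forall n a b,
    @semiladder (delta q G) n a b -> n <= M.
Proof.
elim: r => [|r IH] hC.
  have [M hM] := hC 0 isT; exists M => G CG q; rewrite leqn0 => /eqP-> n a b.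
  by apply: hM; exists G.
have [M hM] := IH (fun q qr => hC q (leqW qr)); have [M' hM'] := hC r.+1 (leqnn _).
exists (maxn M M') => G CG q; rewrite leq_eqVlt => /predU1P[->|qr] n a b lad.
  by rewrite leq_max (hM' (delta r.+1 G) _ n a b lad) ?orbT //; exists G.
by rewrite leq_max (hM G CG q qr n a b lad).
Qed.

(* Without vertices there is exactly one tuple of length [0] and none longer. *)
Definition empty_graph_answer (s t : nat) (phi : dformula s t) : bool :=
  (s == 0) && ((t == 0) ==> evalf phi xpredT).

Lemma empty_graph_answerP (s t : nat) (phi : dformula s t) (G : sgraph) :
  positive phi -> (G -> False) -> empty_graph_answer phi <-> domination_problem phi G.
Proof.
move=> pos G0; rewrite /empty_graph_answer; split=> [/andP[/eqP s0]|[a a_dom]].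
  subst s => ans; exists [tuple] => b.
  case: t phi pos ans b => [|t] phi pos /= ans b; last by case: (G0 (thead b)).
  (* An atom would need an index in ['I_0], so all valuations agree. *)
  by rewrite sat_evalf; apply: evalf_mono ans => // -[q [[]]].
case: s phi pos a a_dom => [|s] phi pos a a_dom; last by case: (G0 (thead a)).
rewrite eqxx /=; apply/implyP => /eqP t0; subst t.
by have := a_dom [tuple]; rewrite sat_evalf; apply: evalf_mono.
Qed.

(* [maxn 1] only matters for the graph without vertices, for which no program
   could halt within [f k * 0] steps. *)
Theorem theorem19 (r : nat) (C : sgraph -> Prop)
  (hC : forall q : nat, q <= r -> finite_semiladder_index (delta_class q C)) :
  exists f : nat -> nat,
    forall (s t : nat) (phi : dformula s t),
      positive phi -> radius phi <= r ->
      exists p : prog,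
        decides_in_time p C (domination_problem phi)
          (fun G : sgraph => f (fsize phi) * maxn 1 (gsize G)).
Proof.
have [M hM] := uniform_semiladder_bound hC.
(* The bound of [size_ladder] for [k] atoms; as [M] depends on the class and [r] only, so does the
   resulting [f]. *)
pose fuel k := ramsey_bound k (k * M.+2).
exists (fun k => (loop_time r k (fuel k) 0).+1) => s t phi pos phi_r.
(* Register 1 is initially 0, so the test singles out the graph without vertices, whose answer is a
   constant of the program. *)
exists (If (TEq 0 1) (Instr (IConst 0 (empty_graph_answer phi)))
          (loop phi (fuel (fsize phi)) 0)).
move=> G CG vs nb Gvs; have [_ vs_all _ _] := Gvs.
set sz := maxn 1 (gsize G); have sz0 : 0 < sz by rewrite leq_max.
suff [m [T [e TT q]]] : wp (If (TEq 0 1) (Instr (IConst 0 (empty_graph_answer phi)))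
    (loop phi (fuel (fsize phi)) 0)) (input vs nb)
    ((loop_time r (fsize phi) (fuel (fsize phi)) 0) * sz).+1
    (fun m => (reg m 0 != 0) <-> domination_problem phi G).
  by exists m, T; split=> //; rewrite mulSn; apply: leq_trans TT _; rewrite -add1n leq_add2r.
apply: wp_if => /= n0.
  have G0 (v : G) : False by have := vs_all v; rewrite (size0nil (eqP n0)).
  apply: (@wp_le _ _ 1).
    by rewrite muln_gt0 sz0 andbT; case: (fuel _).
  apply: wp_instr => /=; rewrite /upd /=; rewrite -(empty_graph_answerP pos G0).
  by case: empty_graph_answer.
case: vs Gvs vs_all n0 => [|x0 vs'] // Gvs _ _.
have d : s.-tuple G * t.-tuple G := (nseq_tuple s x0, nseq_tuple t x0).
have lad : forall L : seq (s.-tuple G * t.-tuple G), ladder phi L ->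
    size L < size (@nil (s.-tuple G * t.-tuple G)) + fuel (fsize phi).
  move=> L; apply: size_ladder pos _ => q q_phi n a b.
  by apply: hM => //; apply: leq_trans q_phi phi_r.
have sz_le : maxn 1 (gsize G) <= sz by [].
have := wp_loop (x0 := x0) Gvs sz_le (L := [::]) (d := d) pos phi_r lad.
apply=> //; exact: good_input.
Qed.
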